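(* Let $(\mathfrak h,\mathfrak g,\mathfrak k)$ be a Manin triple over a field $\mathbb K$ of characteristic $2$ with (even) NIS $\mathscr B_{\mathfrak h}$. Let $\mathscr D\in\mathfrak{der}(\mathfrak h)_{\bar 0}$ satisfy $\mathscr B_{\mathfrak h}(\mathscr D(a),b)+\mathscr B_{\mathfrak h}(a,\mathscr D(b))=0$ for all $a,b\in\mathfrak h$, $\mathscr B_{\mathfrak h}(\mathscr D(a),a)=0$ for all $a\in\mathfrak h_{\bar 0}$, and $\mathscr D(\mathfrak k_{\bar 0})\subseteq\mathfrak k_{\bar 0}$. Let $\alpha:\mathfrak h_{\bar 1}\to\mathbb K$ be a quadratic form with $\alpha(a+b)+\alpha(a)+\alpha(b)=\mathscr B_{\mathfrak h}(a,\mathscr D(b))$ for all $a,b\in\mathfrak h_{\bar 1}$ and $\alpha(\mathfrak k_{\bar 1})=0$. Denote by $(\tilde{\mathfrak h}=\mathscr K\oplus\mathfrak h\oplus\mathscr K^*,\tilde{\mathscr B}_{\tilde{\mathfrak h}})$ the double extension of $(\mathfrak h,\mathscr B_{\mathfrak h})$ by the one-dimensional Lie algebra $\mathscr K=\mathbb Kx$ via $\mathscr D$ and $\alpha$, where $\mathscr K^*=\mathbb Kx^*$. If $\tilde{\mathscr B}_{\tilde{\mathfrak h}}(x^*,x^* )=0$, then $(\tilde{\mathfrak h},\tilde{\mathfrak g},\tilde{\mathfrak k})$ is also a Manin triple with NIS $\tilde{\mathscr B}_{\tilde{\mathfrak h}}$, where $\tilde{\mathfrak g}=\mathscr K\oplus\mathfrak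 g$ and $\tilde{\mathfrak k}=\mathscr K^*\ltimes\mathfrak k$.
   Context: All spaces are finite-dimensional. A Lie superalgebra in characteristic $2$ is a superspace $\mathfrak g=\mathfrak g_{\bar 0}\oplus\mathfrak g_{\bar 1}$ such that $\mathfrak g_{\bar 0}$ is a Lie algebra, $\mathfrak g_{\bar 1}$ is a $\mathfrak g_{\bar 0}$-module made two-sided by symmetry, together with a squaring $s_{\mathfrak g}:\mathfrak g_{\bar 1}\to\mathfrak g_{\bar 0}$ with $s_{\mathfrak g}(\lambda x)=\lambda^2 s_{\mathfrak g}(x)$ such that $[x,y]_{\mathfrak g}:=s_{\mathfrak g}(x+y)-s_{\mathfrak g}(x)-s_{\mathfrak g}(y)$ is bilinear on $\mathfrak g_{\bar 1}$, and $[s_{\mathfrak g}(x),y]_{\mathfrak g}=[x,[x,y]_{\mathfrak g}]_{\mathfrak g}$ for $x\in\mathfrak g_{\bar 1}$, $y\in\mathfrak g$. A derivation is a linear map $D$ with $D([x,y])=[D(x),y]+[x,D(y)]$ for $x\in\mathfrak g_{\bar 0},y\in\mathfrak g$ and $D(s_{\mathfrak g}(x))=[D(x),x]$ for $x\in\mathfrak g_{\bar 1}$; $\mathfrak{der}(\mathfrak g)_{\bar 0}$ denotes the even ones. Sub-superalgebras are closed under bracket and squaring. NIS: a non-degenerate invariant ($\mathscr B([x,y],z)=\mathscr B(x,[y,z])$) symmetric bilinear form with $\mathscr B(x,x)=0$ for odd $x$. A Manin triple $(\mathfrak h,\mathfrak g,\mathfrak k)$: $\mathfrak h$ is a Lie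 superalgebra, $\mathfrak g,\mathfrak k$ are Lie sub-superalgebras with $\mathfrak h=\mathfrak g\oplus\mathfrak k$ as vector spaces, and there is an even NIS on $\mathfrak h$ for which $\mathfrak g$ and $\mathfrak k$ are isotropic ($\mathscr B(\mathfrak g,\mathfrak g)=\mathscr B(\mathfrak k,\mathfrak k)=0$). Double extension ($\mathscr D_{\bar 0}$-extension) of $(\mathfrak h,\mathscr B_{\mathfrak h})$ via $\mathscr D,\alpha$: $\tilde{\mathfrak h}=\mathbb Kx\oplus\mathfrak h\oplus\mathbb Kx^*$ with $x,x^*$ even, squaring $s_{\tilde{\mathfrak h}}(a)=s_{\mathfrak h}(a)+\alpha(a)x$ for $a\in\mathfrak h_{\bar 1}$, bracket $[x,\tilde{\mathfrak h}]=0$, $[a,b]_{\tilde{\mathfrak h}}=[a,b]_{\mathfrak h}+\mathscr B_{\mathfrak h}(\mathscr D(a),b)x$, $[x^*,a]_{\tilde{\mathfrak h}}=\mathscr D(a)$ ($a,b\in\mathfrak h$), form $\tilde{\mathscr B}|_{\mathfrak h\times\mathfrak h}=\mathscr B_{\mathfrak h}$, $\tilde{\mathscr B}(\mathfrak h,x)=\tilde{\mathscr B}(\mathfrak h,x^* )=0$, $\tilde{\mathscr B}(x,x^* )=1$, $\tilde{\mathscr B}(x,x)=0$, $\tilde{\mathscr B}(x^*,x^* )$ arbitrary. This is an even NIS-Lie superalgebra. *)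

(* Defs.v *)
From HB Require Import structures.
From mathcomp Require Import all_boot all_order all_algebra.
Set Implicit Arguments.
Unset Strict Implicit.
Unset Printing Implicit Defensive.
Import GRing.Theory.
Local Open Scope ring_scope.

(* Raw data of a finite-dimensional superalgebra with a squaring. The squaring
   is a total function, but only its values on [od] are ever constrained or
   meaningful. *)
Record superAlg (K : fieldType) := SuperAlg {
  carrier :> vectType K;
  ev : {vspace carrier};
  od : {vspace carrier};
  br : carrier -> carrier -> carrier;
  sq : carrier -> carrier }.

Arguments ev {K} s.
Arguments od {K} s.
Arguments br {K s} _ _.
Arguments sq {K s} _.

Section Superalgebras.
Variables (K : fieldType) (h : superAlg K).
Implicit Types (g k W L I : {vspace h}) (B : h -> h -> K) (D : 'End(h)).

Definition is_direct_sum g k W : Prop := (g + k)%VS = W /\ (g :&: k)%VS = 0%VS.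

(* Meant for K of characteristic 2. A Lie algebra in characteristic 2 has an
   alternating bracket; the right action of [ev] on [od] is the left one. *)
Record is_lie_superalgebra : Prop := IsLieSuperalgebra {
  super_decomp : is_direct_sum (ev h) (od h) fullv;
  br_bilinear : bilinear_for *:%R *:%R (@br K h);
  br_ev_ev : {in ev h &, forall x y, br x y \in ev h};
  br_ev_od : {in ev h & od h, forall x y, br x y \in od h};
  sq_od : {in od h, forall x, sq x \in ev h};
  br_ev_alt : {in ev h, forall x, br x x = 0};
  br_ev_jacobi : {in ev h & ev h & ev h, forall x y z,
    br x (br y z) + br y (br z x) + br z (br x y) = 0};
  br_module : {in ev h & ev h & od h, forall x y z,
    br (br x y) z = br x (br y z) - br y (br x z)};
  br_od_ev : {in ev h & od h, forall x y, br y x = br x y};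
  sq_scale : forall (l : K), {in od h, forall x, sq (l *: x) = l ^+ 2 *: sq x};
  br_od_od : {in od h &, forall x y, br x y = sq (x + y) - sq x - sq y};
  br_sq : {in od h, forall x y, br (sq x) y = br x (br x y)} }.

Record is_sub_superalgebra W : Prop := IsSubSuperalgebra {
  sub_graded : W = (W :&: ev h + W :&: od h)%VS;
  sub_br : {in W &, forall x y, br x y \in W};
  sub_sq : {in (W :&: od h)%VS, forall x, sq x \in W} }.

Record is_even_derivation D : Prop := IsEvenDerivation {
  der_ev : {in ev h, forall x, D x \in ev h};
  der_od : {in od h, forall x, D x \in od h};
  der_br : {in ev h, forall x y, D (br x y) = br (D x) y + br x (D y)};
  der_sq : {in od h, forall x, D (sq x) = br (D x) x} }.

Record is_NIS B : Prop := IsNIS {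
  nis_bilinear : bilinear_for *%R *%R B;
  nis_sym : forall x y, B x y = B y x;
  nis_nondeg : forall x, (forall y, B x y = 0) -> x = 0;
  nis_inv : forall x y z, B (br x y) z = B x (br y z);
  nis_od : {in od h, forall x, B x x = 0} }.

Definition is_even_form B : Prop := {in ev h & od h, forall x y, B x y = 0}.

Definition isotropic B W : Prop := {in W &, forall x y, B x y = 0}.

(* (h, g, k) is a Manin triple, witnessed by the even NIS form B. *)
Record is_Manin_triple_with g k B : Prop := IsManinTripleWith {
  manin_lie : is_lie_superalgebra;
  manin_sub_l : is_sub_superalgebra g;
  manin_sub_r : is_sub_superalgebra k;
  manin_sum : is_direct_sum g k fullv;
  manin_nis : is_NIS B;
  manin_even : is_even_form B;
  manin_iso_l : isotropic B g;
  manin_iso_r : isotropic B k }.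

(* Only the restriction of q to W is constrained; the polar form is symmetric,
   so linearity in the first argument gives bilinearity. *)
Definition is_quadratic_form_on W (q : h -> K) : Prop :=
  let polar a b := q (a + b) - q a - q b in
  (forall (l : K), {in W, forall a, q (l *: a) = l ^+ 2 * q a}) /\
  (forall (l : K), {in W & W & W, forall a b c,
     polar (l *: a + b) c = l * polar a c + polar b c}).

(* W is the internal semidirect product L |x I, with ideal I. *)
Record is_semidirect_product W L I : Prop := IsSemidirectProduct {
  sdp_sum : is_direct_sum L I W;
  sdp_sub : is_sub_superalgebra L;
  sdp_ideal_sub : is_sub_superalgebra I;
  sdp_ideal : {in W & I, forall x y, br x y \in I} }.

End Superalgebras.

Arguments is_lie_superalgebra {K} h.
Arguments is_Manin_triple_with {K} h g k B.

(* The restriction of f to W identifies W with a sub-superalgebra of h'. *)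
Record is_embedding_on (K : fieldType) (h h' : superAlg K)
    (W : {vspace h}) (f : 'Hom(h, h')) : Prop := IsEmbeddingOn {
  emb_inj : {in W &, injective f};
  emb_ev : {in (W :&: ev h)%VS, forall a, f a \in ev h'};
  emb_od : {in (W :&: od h)%VS, forall a, f a \in od h'};
  emb_br : {in W &, forall a b, f (br a b) = br (f a) (f b)};
  emb_sq : {in (W :&: od h)%VS, forall a, f (sq a) = sq (f a)} }.

Section DoubleExtension.
Variables (K : fieldType) (h : superAlg K).
Variables (B : h -> h -> K) (D : 'End(h)) (alpha : h -> K).

(* The triple (p, a, q) stands for p x + a + q x^*. *)
Definition dext_space : vectType K := (K^o * h * K^o)%type.

Definition dext_vec (p : K) (a : h) (q : K) : dext_space := (p, a, q).

Definition dext_x : dext_space := dext_vec 1 0 0.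
Definition dext_xs : dext_space := dext_vec 0 0 1.

Definition dext_in (a : h) : dext_space := dext_vec 0 a 0.

Fact dext_in_linear : linear dext_in.
Proof.
move=> l a b; rewrite /dext_in /dext_vec.
by congr (_, _, _); rewrite /= [l *: _]mulr0 addr0.
Qed.

HB.instance Definition _ :=
  GRing.isLinear.Build K h dext_space _ dext_in dext_in_linear.

Definition dext_emb : 'Hom(h, dext_space) := linfun dext_in.

(* [x, -] = 0, [a, b] = [a, b]_h + B (D a) b x, and [x^*, a] = [a, x^*] = D a
   (no sign: characteristic 2); x^* being even, [x^*, x^*] = 0. *)
Definition dext_br (t u : dext_space) : dext_space :=
  dext_vec (B (D t.1.2) u.1.2)
           (br t.1.2 u.1.2 + t.2 *: D u.1.2 + u.2 *: D t.1.2)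
           0.

(* Meaningful on the odd part, whose elements are (0, a, 0) with a odd. *)
Definition dext_sq (t : dext_space) : dext_space :=
  dext_vec (alpha t.1.2) (sq t.1.2) 0.

Definition dext : superAlg K := {|
  carrier := dext_space;
  ev := (<[dext_x]> + dext_emb @: ev h + <[dext_xs]>)%VS;
  od := (dext_emb @: od h)%VS;
  br := dext_br;
  sq := dext_sq |}.

(* c is the (arbitrary) value of the form on the pair x^*, x^*. *)
Definition dext_form (c : K) (t u : dext) : K :=
  B t.1.2 u.1.2 + t.1.1 * u.2 + t.2 * u.1.1 + c * (t.2 * u.2).

Definition dext_K : {vspace dext} := <[dext_x]>%VS.
Definition dext_Ks : {vspace dext} := <[dext_xs]>%VS.
Definition dext_lift : 'Hom(h, dext) := dext_emb.

End DoubleExtension.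

(* Main.v *)
Require Import Defs.
From HB Require Import structures.
From mathcomp Require Import all_boot all_order all_algebra.
Set Implicit Arguments.
Unset Strict Implicit.
Unset Printing Implicit Defensive.
Import GRing.Theory.
Local Open Scope ring_scope.

(** The double extension of a Manin triple is checked on triples (p, a, q),
    standing for p x + a + q x^*; every subspace that occurs (the two parities,
    K x + W, K x^* + W for W in h) is cut out by conditions on p, a and q
    separately.

    That the double extension is a Lie superalgebra with an even NIS is a
    statement about h, B, D and alpha alone. The cocycle (a, b) |-> B (D a) b
    satisfies the Jacobi identity because, by invariance, the cyclic sum is B
    applied to the Leibniz rule for D [a, b] ([cocycle_D]); the h-components of
    the axioms are again Leibniz rules, whose remaining terms occur in equal
    pairs and cancel in characteristic 2. Alternation on the even part is the
    hypothesis B (D a) a = 0, and the squaring polarizes to the bracket because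
    the polar form of alpha is the cocycle.

    The point specific to Manin triples is that k + K x^* must be closed under
    bracket and squaring, that is, D preserves k, the cocycle vanishes on k and
    alpha vanishes on the odd part of k. The second follows from the first as k
    is isotropic. For the first, only the even part of k is known to be
    D-stable; but on the odd part of k the polar form B a (D b) of alpha
    vanishes along with alpha, so D b is orthogonal to all of k, and an element
    orthogonal to k lies in k, since h is the sum of the two isotropic subspaces
    g and k ([manin_perp_r], [derivation_stable_r]). On the side of g, the line
    K x is central and contains all values of the cocycle and of alpha, so it
    extends g to a sub-superalgebra. *)

(* Otherwise simplification would unfold the parities of a double extension into
   sums of images, out of reach of the membership lemmas. *)
Local Arguments ev {K} s : simpl never.
Local Arguments od {K} s : simpl never.

(** * Bilinear maps and characteristic 2 *)

Section BilinearMaps.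
Variables (R : nzRingType) (U U' : lmodType R) (V : zmodType).
Variables (s s' : GRing.Scale.law R V) (f : U -> U' -> V).
Hypothesis bilin : bilinear_for s s' f.

Lemma bilinear0l b : f 0 b = 0.
Proof.
by have := zmod_morphism_linear (bilin.1 b) 0 0; rewrite !subrr.
Qed.

Lemma bilinear0r a : f a 0 = 0.
Proof.
by have := zmod_morphism_linear (bilin.2 a) 0 0; rewrite !subrr.
Qed.

Lemma bilinearDl a a' b : f (a + a') b = f a b + f a' b.
Proof.
have fB := zmod_morphism_linear (bilin.1 b).
by rewrite -{2}(addrK a' a) fB subrK.
Qed.

Lemma bilinearDr a b b' : f a (b + b') = f a b + f a b'.
Proof.
have fB := zmod_morphism_linear (bilin.2 a).
by rewrite -{2}(addrK b' b) fB subrK.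
Qed.

Lemma bilinearZl l a b : f (l *: a) b = s l (f a b).
Proof. exact: (scalable_linear (bilin.1 b)). Qed.

Lemma bilinearZr l a b : f a (l *: b) = s' l (f a b).
Proof. exact: (scalable_linear (bilin.2 a)). Qed.

End BilinearMaps.

Section CharacteristicTwo.
Variables (K : fieldType) (charK2 : 2%N \in [pchar K]) (V : lmodType K).

Lemma addvv_pchar2 (v : V) : v + v = 0.
Proof. by rewrite -mulr2n -scaler_nat (pcharf0 charK2) scale0r. Qed.

Lemma oppv_pchar2 (v : V) : - v = v.
Proof. by apply/eqP; rewrite eq_sym -addr_eq0 addvv_pchar2. Qed.

End CharacteristicTwo.

(** * Consequences of the Lie superalgebra axioms *)

Section LieSuperalgebras.
Variables (K : fieldType) (charK2 : 2%N \in [pchar K]) (h : superAlg K).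
Hypothesis lie_h : is_lie_superalgebra h.

(** The inclusion from right to left always holds, so gradedness can be checked
    one vector at a time. *)
Lemma graded_subspace (W : {vspace h}) :
    (forall w, w \in W -> exists2 a, a \in (W :&: ev h)%VS &
                          exists2 b, b \in (W :&: od h)%VS & w = a + b) ->
  W = (W :&: ev h + W :&: od h)%VS.
Proof.
move=> splitW; apply/eqP; rewrite eqEsubv subv_add !capvSl !andbT.
by apply/subvP=> w /splitW Ww; apply/memv_addP.
Qed.

Lemma parity_split (a : h) :
  exists2 a0, a0 \in ev h & exists2 a1, a1 \in od h & a = a0 + a1.
Proof.
by case: (super_decomp lie_h) => full _; apply/memv_addP; rewrite full memvf.
Qed.

Lemma ev_od_eq0 (a : h) : a \in ev h -> a \in od h -> a = 0.
Proof.
move=> a0 a1; apply/eqP; rewrite -memv0; case: (super_decomp lie_h) => _ <-.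
exact/memv_capP.
Qed.

(** An alternating bracket is antisymmetric, hence symmetric as signs vanish. *)
Lemma br_evC : {in ev h &, forall x y, br x y = br y x}.
Proof.
move=> x y xe ye; have := br_ev_alt lie_h (rpredD xe ye).
rewrite (bilinearDl (br_bilinear lie_h)) !(bilinearDr (br_bilinear lie_h)).
rewrite !(br_ev_alt lie_h) // addr0 add0r => /eqP.
by rewrite addr_eq0 oppv_pchar2 // => /eqP.
Qed.

Lemma br_odC : {in od h &, forall x y, br x y = br y x}.
Proof.
by move=> x y xo yo; rewrite !(br_od_od lie_h) // [y + x]addrC addrAC.
Qed.

Lemma sq0 : sq (0 : h) = 0.
Proof. by have := sq_scale lie_h 0 (mem0v (od h)); rewrite expr0n !scale0r. Qed.

End LieSuperalgebras.

(** * Subspaces of the double extension, in coordinates *)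

Section DoubleExtensionSpace.
Variables (K : fieldType) (h : superAlg K).
Variables (B : h -> h -> K) (D : 'End(h)) (alpha : h -> K).
Local Notation ht := (dext B D alpha).
Local Notation iota := (dext_lift B D alpha).
Local Notation calK := (dext_K B D alpha).
Local Notation calKs := (dext_Ks B D alpha).
Local Notation vec p a q := (@dext_vec K h p a q : ht).
Implicit Types (t : ht) (W : {vspace h}).

Lemma dext_eq (t t' : dext_space h) :
  t.1.1 = t'.1.1 -> t.1.2 = t'.1.2 -> t.2 = t'.2 -> t = t'.
Proof. by move: t t' => [[p a] q] [[p' a'] q'] /= -> -> ->. Qed.

Lemma liftE (a : h) : iota a = vec 0 a 0.
Proof. by rewrite /dext_lift /dext_emb lfunE. Qed.

Lemma mem_K t :
  (t \in calK) = (t.1.2 == 0) && (t.2 == 0).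
Proof.
apply/vlineP/andP => [[l ->] | [/eqP a0 /eqP q0]].
  by split; apply/eqP; [exact: scaler0 | exact: mulr0].
exists t.1.1; apply: dext_eq.
- by rewrite /= [_ *: _]mulr1.
- by rewrite /= scaler0.
- by rewrite /= [_ *: _]mulr0.
Qed.

Lemma mem_Ks t :
  (t \in calKs) = (t.1.1 == 0) && (t.1.2 == 0).
Proof.
apply/vlineP/andP => [[l ->] | [/eqP a0 /eqP q0]].
  by split; apply/eqP; [exact: mulr0 | exact: scaler0].
exists t.2; apply: dext_eq.
- by rewrite /= [_ *: _]mulr0.
- by rewrite /= scaler0.
- by rewrite /= [_ *: _]mulr1.
Qed.

Lemma mem_lift W t :
  (t \in (iota @: W)%VS) = [&& t.1.1 == 0, t.1.2 \in W & t.2 == 0].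
Proof.
apply/memv_imgP/and3P => [[a Wa ->] | [/eqP p0 Wa /eqP q0]].
  by rewrite liftE /= eqxx.
by exists t.1.2 => //; rewrite liftE; apply: dext_eq.
Qed.

Lemma mem_K_lift W t :
  (t \in (calK + iota @: W)%VS) = (t.1.2 \in W) && (t.2 == 0).
Proof.
apply/memv_addP/andP => [[u] | [Wa q0]].
  rewrite mem_K => /andP[/eqP a0 /eqP q0] [v].
  rewrite mem_lift => /and3P[_ Wa /eqP q0'] -> /=.
  by rewrite a0 add0r q0 q0' addr0.
exists (vec t.1.1 0 0); first by rewrite mem_K /= !eqxx.
exists (vec 0 t.1.2 0); first by rewrite mem_lift /= Wa !eqxx.
by apply: dext_eq; rewrite /= ?addr0 ?add0r // (eqP q0).
Qed.

Lemma mem_Ks_lift W t :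
  (t \in (calKs + iota @: W)%VS) = (t.1.1 == 0) && (t.1.2 \in W).
Proof.
apply/memv_addP/andP => [[u] | [p0 Wa]].
  rewrite mem_Ks => /andP[/eqP p0 /eqP a0] [v].
  rewrite mem_lift => /and3P[/eqP p0' Wa _] -> /=.
  by rewrite a0 add0r p0 p0' addr0.
exists (vec 0 0 t.2); first by rewrite mem_Ks /= !eqxx.
exists (vec 0 t.1.2 0); first by rewrite mem_lift /= Wa !eqxx.
by apply: dext_eq; rewrite /= ?addr0 ?add0r // (eqP p0).
Qed.

Lemma mem_ev t : (t \in ev ht) = (t.1.2 \in ev h).
Proof.
apply/memv_addP/idP => [[u] | ae].
  rewrite mem_K_lift => /andP[ae _] [v].
  by rewrite mem_Ks => /andP[_ /eqP a0] -> /=; rewrite a0 addr0.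
exists (vec t.1.1 t.1.2 0); first by rewrite mem_K_lift /= ae eqxx.
exists (vec 0 0 t.2); first by rewrite mem_Ks /= !eqxx.
by apply: dext_eq; rewrite /= ?addr0 ?add0r.
Qed.

Lemma mem_od t : (t \in od ht) = [&& t.1.1 == 0, t.1.2 \in od h & t.2 == 0].
Proof. exact: mem_lift. Qed.

End DoubleExtensionSpace.

(** * The double extension is an even NIS-Lie superalgebra *)

Section NISDoubleExtension.
Variables (K : fieldType) (charK2 : 2%N \in [pchar K]) (h : superAlg K).
Variables (B : h -> h -> K) (D : 'End(h)) (alpha : h -> K).
Hypotheses (lie_h : is_lie_superalgebra h) (nisB : is_NIS B).
Hypotheses (evenB : is_even_form B) (derD : is_even_derivation D).
Hypothesis skewD : forall a b, B (D a) b + B a (D b) = 0.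
Hypothesis altD : {in ev h, forall a, B (D a) a = 0}.
Hypothesis quad_alpha : is_quadratic_form_on (od h) alpha.
Hypothesis polar_alpha : {in od h &, forall a b,
  alpha (a + b) + alpha a + alpha b = B a (D b)}.
Local Notation ht := (dext B D alpha).
Local Notation vec p a q := (@dext_vec K h p a q : ht).

Let bilB := nis_bilinear nisB.
Let bilbr := br_bilinear lie_h.
Let evC := br_evC charK2 lie_h.

Lemma skew_swap a b : B (D a) b = B a (D b).
Proof. by apply/eqP; rewrite -subr_eq0 (GRing.subr_pchar2 charK2) skewD. Qed.

Lemma even_form_od_ev : {in od h & ev h, forall a b, B a b = 0}.
Proof. by move=> a b ao be; rewrite (nis_sym nisB) evenB. Qed.

(** Invariance turns the first two terms into B (D [a, b]) c, by the Leibniz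
    rule; the third is B (D c) [a, b], which is the same scalar since D is
    self-adjoint in characteristic 2. *)
Lemma cocycle_D : {in ev h & ev h & ev h, forall a b c,
  B (D a) (br b c) + B (D b) (br c a) + B (D c) (br a b) = 0}.
Proof.
move=> a b c ae be ce; have [Dae Dbe] := (der_ev derD ae, der_ev derD be).
rewrite [br c a]evC // -!(nis_inv nisB) [br (D b) a]evC //.
rewrite -(bilinearDl bilB) -(der_br derD) // [B (br (D c) a) b](nis_inv nisB).
by rewrite [B (D c) _](nis_sym nisB) -skew_swap (addrr_pchar2 charK2).
Qed.

Lemma dext_br_bilinear : bilinear_for *:%R *:%R (@br K ht).
Proof.
split=> [[[p b] q] l | [[p b] q] l] [[p1 a1] q1] [[p2 a2] q2].
  apply: dext_eq => /=; last by rewrite scaler0 addr0.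
    by rewrite linearP (bilinearDl bilB) (bilinearZl bilB).
  rewrite linearP (bilinearDl bilbr) (bilinearZl bilbr) /=.
  rewrite !scalerDl !scalerDr !scalerA [q * l]mulrC.
  by rewrite (AC (2*2*2) ((1*3*5)*(2*4*6))).
apply: dext_eq => /=; last by rewrite scaler0 addr0.
  by rewrite (bilinearDr bilB) (bilinearZr bilB).
rewrite linearP (bilinearDr bilbr) (bilinearZr bilbr) /=.
rewrite !scalerDl !scalerDr !scalerA [q * l]mulrC.
by rewrite (AC (2*2*2) ((1*3*5)*(2*4*6))).
Qed.

(** The x-component is [cocycle_D] plus multiples of B (D a) (D b) and the like,
    each of which occurs twice. In the h-component the Leibniz rule expands
    D [b, c]; apart from the Jacobi identity of h, again all terms pair up. *)
Lemma dext_jacobi : {in ev ht & ev ht & ev ht, forall t u v,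
  br t (br u v) + br u (br v t) + br v (br t u) = 0}.
Proof.
move=> [[p a] q] [[p' b] q'] [[p'' c] q'']; rewrite !mem_ev /= => ae be ce.
have [Dae [Dbe Dce]] := (der_ev derD ae, (der_ev derD be, der_ev derD ce)).
apply: dext_eq => /=; last by rewrite !addr0.
  rewrite !(bilinearDr bilB) !(bilinearZr bilB).
  rewrite [B (D c) (D a)](nis_sym nisB) [B (D c) (D b)](nis_sym nisB).
  rewrite [B (D b) (D a)](nis_sym nisB).
  rewrite (AC (3*3*3) ((1*4*7)*((2*9)*(3*5)*(6*8)))) /=.
  by rewrite cocycle_D // !(addrr_pchar2 charK2).
rewrite !scale0r !addr0 !linearD /= !linearZ /= !(der_br derD) //.
rewrite !(bilinearDr bilbr) !(bilinearZr bilbr).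
rewrite !scalerDr !scalerA [q' * q]mulrC [q'' * q]mulrC [q'' * q']mulrC.
rewrite [br (D b) c]evC // [br (D c) a]evC // [br (D a) b]evC //.
(* Terms 1, 8 and 15 are the Jacobi sum of h; the others are grouped into equal
   pairs. *)
rewrite (AC ((3*4)*(3*4)*(3*4)) ((1*8*15)*((2*11)*(3*19)*(4*16)*(5*10)*(6*14)
  *(7*20)*(9*18)*(12*17)*(13*21)))) /=.
by rewrite (br_ev_jacobi lie_h) // !(addvv_pchar2 charK2).
Qed.

(** Here the x-components vanish, since brackets of even and odd elements are
    odd and B is even. *)
Lemma dext_module : {in ev ht & ev ht & od ht, forall t u v,
  br (br t u) v = br t (br u v) - br u (br t v)}.
Proof.
move=> [[p a] q] [[p' b] q'] [[p'' c] q'']; rewrite !mem_ev mem_od /= => ae be.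
move=> /and3P[_ co /eqP->].
have [Dae [Dbe Dco]] := (der_ev derD ae, (der_ev derD be, der_od derD co)).
have ev_br x y : x \in ev h -> y \in ev h -> br x y \in ev h by exact: br_ev_ev.
have od_br x y : x \in ev h -> y \in od h -> br x y \in od h by exact: br_ev_od.
apply: dext_eq => /=; last by rewrite subr0.
  rewrite !scale0r !addr0.
  by rewrite !evenB ?subr0 ?(der_ev derD) ?rpredD ?rpredZ ?od_br ?ev_br.
rewrite !scale0r !addr0 !linearD /= !linearZ /= !(der_br derD) //.
rewrite !(bilinearDr bilbr) !(bilinearZr bilbr).
rewrite !(bilinearDl bilbr) !(bilinearZl bilbr) (br_module lie_h) //.
rewrite !(oppv_pchar2 charK2) !scalerDr !scalerA.
(* The last six terms are equal in pairs. *)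
rewrite [RHS](AC ((2*3)*(2*3)) ((1*6*3*8)*((2*9)*(4*7)*(5*10)))) /=.
by rewrite !(addvv_pchar2 charK2) addr0.
Qed.

(** The rule D (s a) = [D a, a] gives both components; the x-component also
    contains B (D a) (D a), which vanishes because D a is odd. *)
Lemma dext_br_sq : {in od ht, forall t u, br (sq t) u = br t (br t u)}.
Proof.
move=> [[p a] q] + [[p' b] q']; rewrite mem_od /= => /and3P[_ ao /eqP->].
have Dao := der_od derD ao.
apply: dext_eq => //=.
  rewrite scale0r addr0 (bilinearDr bilB) (bilinearZr bilB) (nis_od nisB) //.
  by rewrite /= mulr0 addr0 (der_sq derD) // (nis_inv nisB).
rewrite !scale0r !addr0 (bilinearDr bilbr) (bilinearZr bilbr) (br_sq lie_h) //.
by rewrite (der_sq derD) // [br (D a) a](br_odC lie_h).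
Qed.

Lemma dext_lie_superalgebra : is_lie_superalgebra ht.
Proof.
split.
- split; apply/eqP; last first.
    rewrite -subv0; apply/subvP=> t /memv_capP[].
    rewrite mem_ev mem_od memv0 => ae /and3P[/eqP p0 ao /eqP q0].
    by apply/eqP/dext_eq; rewrite ?p0 ?q0 ?(ev_od_eq0 lie_h ae ao).
  rewrite eqEsubv subvf; apply/subvP=> -[[p a] q] _.
  have [a0 a0e [a1 a1o ->]] := parity_split lie_h a; apply/memv_addP.
  exists (vec p a0 q); first by rewrite mem_ev.
  exists (vec 0 a1 0); first by rewrite mem_od /= a1o !eqxx.
  by apply: dext_eq; rewrite /= ?addr0.
- exact: dext_br_bilinear.
- move=> t u; rewrite !mem_ev /= => ae be.
  by rewrite !rpredD ?rpredZ ?(br_ev_ev lie_h) ?(der_ev derD).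
- move=> [[p a] q] [[p' b] q']; rewrite mem_ev !mem_od /= => ae.
  move=> /and3P[_ bo /eqP->].
  rewrite evenB ?(der_ev derD) // scale0r addr0 !eqxx andbT /=.
  by rewrite rpredD ?rpredZ ?(br_ev_od lie_h) ?(der_od derD).
- by move=> t; rewrite mem_od mem_ev => /and3P[_ ao _]; apply: sq_od.
- move=> t; rewrite mem_ev => ae; apply: dext_eq => //=.
    exact: altD.
  by rewrite (br_ev_alt lie_h) // add0r (addvv_pchar2 charK2).
- exact: dext_jacobi.
- exact: dext_module.
- move=> [[p a] q] [[p' b] q']; rewrite mem_ev mem_od /= => ae.
  move=> /and3P[_ bo /eqP->].
  have [Dae Dbo] := (der_ev derD ae, der_od derD bo).
  apply: dext_eq => //=; first by rewrite even_form_od_ev // evenB.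
  by rewrite !scale0r !addr0 (br_od_ev lie_h).
- move=> l t; rewrite mem_od => /and3P[_ ao _].
  apply: dext_eq => /=; last by rewrite scaler0.
    exact: quad_alpha.1.
  exact: sq_scale.
- move=> [[p a] q] [[p' b] q']; rewrite !mem_od /=.
  move=> /and3P[/eqP-> ao /eqP->] /and3P[/eqP-> bo /eqP->].
  apply: dext_eq => /=; last by rewrite !subr0.
    by rewrite skew_swap -polar_alpha // !(oppr_pchar2 charK2).
  by rewrite !scale0r !addr0 (br_od_od lie_h).
- exact: dext_br_sq.
Qed.

Lemma dext_form_sym c (t u : ht) : dext_form c t u = dext_form c u t.
Proof.
rewrite /dext_form [B t.1.2 _](nis_sym nisB) [u.2 * t.2]mulrC.
by rewrite [t.1.1 * _]mulrC [u.1.1 * _]mulrC [_ + _ * u.1.1]addrAC.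
Qed.

Lemma dext_form_linear c (u : ht) :
  linear_for *%R (dext_form c ^~ u : ht -> K).
Proof.
case: u => [[p b] q] l [[p1 a1] q1] [[p2 a2] q2]; rewrite /dext_form /=.
rewrite (bilinearDl bilB) (bilinearZl bilB) /=.
rewrite -![_ *: _]/(_ * _) !mulrDl !mulrDr -!mulrA [c * (l * _)]mulrCA.
by rewrite (AC (2*2*2*2) ((1*3*5*7)*(2*4*6*8))).
Qed.

Lemma dext_form_inv c (t u v : ht) :
  dext_form c (br t u) v = dext_form c t (br u v).
Proof.
move: t u v => [[p a] q] [[p' b] q'] [[p'' c'] q'']; rewrite /dext_form /=.
rewrite !(bilinearDl bilB) !(bilinearDr bilB).
rewrite !(bilinearZl bilB) !(bilinearZr bilB) /= (nis_inv nisB).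
rewrite !mul0r !mulr0 !addr0 !skew_swap.
by rewrite [_ * q'']mulrC [LHS](AC 4 (1*3*4*2)).
Qed.

(** Nondegeneracy holds for every value c of the form on x^*: pairing with x
    reads off q, pairing with x^* then reads off p, and B detects a. *)
Lemma dext_NIS c : is_NIS (dext_form c : ht -> ht -> K).
Proof.
split; [split=> [u | t] | | | |].
- exact: dext_form_linear.
- by move=> l u v; rewrite !(dext_form_sym c t); apply: dext_form_linear.
- exact: dext_form_sym.
- move=> [[p a] q] t_perp.
  have q0 : q = 0.
    have := t_perp (vec 1 0 0); rewrite /dext_form /=.
    by rewrite (bilinear0r bilB) !mulr0 !addr0 add0r mulr1.
  have p0 : p = 0.
    have := t_perp (vec 0 0 1); rewrite /dext_form /= q0.
    by rewrite (bilinear0r bilB) !mul0r mulr0 !addr0 add0r mulr1.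
  have a0 : a = 0.
    apply: (nis_nondeg nisB) => b; have := t_perp (vec 0 b 0).
    by rewrite /dext_form /= !mulr0 !addr0.
  by rewrite p0 q0 a0.
- exact: dext_form_inv.
- move=> t; rewrite mem_od => /and3P[/eqP p0 ao /eqP q0].
  by rewrite /dext_form p0 q0 !(mul0r, mulr0) !addr0 (nis_od nisB).
Qed.

Lemma dext_form_even c : is_even_form (dext_form c : ht -> ht -> K).
Proof.
move=> t u; rewrite mem_ev mem_od => ae /and3P[/eqP p0 bo /eqP q0].
by rewrite /dext_form p0 q0 !mulr0 !addr0 evenB.
Qed.

End NISDoubleExtension.

(** * Extending sub-superalgebras by x and by x^* *)

Section SubSuperalgebras.
Variables (K : fieldType) (h : superAlg K).
Variables (B : h -> h -> K) (D : 'End(h)) (alpha : h -> K).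
Hypotheses (lie_h : is_lie_superalgebra h) (nisB : is_NIS B).
Hypothesis quad_alpha : is_quadratic_form_on (od h) alpha.
Variable (W : {vspace h}).
Hypothesis subW : is_sub_superalgebra W.
Local Notation ht := (dext B D alpha).
Local Notation vec p a q := (@dext_vec K h p a q : ht).
Local Notation iota := (dext_lift B D alpha).
Local Notation calK := (dext_K B D alpha).
Local Notation calKs := (dext_Ks B D alpha).

Let bilB := nis_bilinear nisB.

Lemma sub_parity_split (a : h) : a \in W ->
  exists2 a0, a0 \in W /\ a0 \in ev h &
  exists2 a1, a1 \in W /\ a1 \in od h & a = a0 + a1.
Proof.
rewrite {1}(sub_graded subW) => /memv_addP[a0 /memv_capP a0P].
by case=> a1 /memv_capP a1P ->; exists a0 => //; exists a1.
Qed.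

(** The cocycle and alpha take values in K x, which the subspace contains. *)
Lemma K_lift_sub_superalgebra : is_sub_superalgebra (calK + iota @: W)%VS.
Proof.
split.
- apply: graded_subspace => -[[p a] q]; rewrite mem_K_lift.
  move=> /andP[/= /sub_parity_split[a0 [a0W a0e] [a1 [a1W a1o] ->]] /eqP->].
  exists (vec p a0 0); first by rewrite memv_cap mem_K_lift mem_ev /= a0W eqxx.
  exists (vec 0 a1 0); last by apply: dext_eq; rewrite /= ?addr0.
  by rewrite memv_cap mem_K_lift mem_od /= a1W a1o eqxx.
- move=> [[p a] q] [[p' b] q']; rewrite !mem_K_lift /=.
  move=> /andP[aW /eqP->] /andP[bW /eqP->].
  by rewrite !scale0r !addr0 (sub_br subW) ?eqxx.
- move=> t /memv_capP[]; rewrite !mem_K_lift mem_od /= => /andP[aW _].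
  by move=> /and3P[_ ao _]; rewrite (sub_sq subW) ?eqxx ?memv_cap ?aW.
Qed.

Hypothesis isoW : isotropic B W.
Hypothesis DW : {in W, forall a, D a \in W}.
Hypothesis alphaW : {in (W :&: od h)%VS, forall a, alpha a = 0}.

(** On an isotropic D-stable W the cocycle B (D a) b vanishes, which makes the
    inclusion of W multiplicative. *)
Lemma lift_br : {in W &, forall a b, iota (br a b) = br (iota a) (iota b)}.
Proof.
move=> a b aW bW; rewrite !liftE; apply: dext_eq => //=.
  by rewrite isoW ?DW.
by rewrite !scale0r !addr0.
Qed.

Lemma lift_sq : {in (W :&: od h)%VS, forall a, iota (sq a) = sq (iota a)}.
Proof.
by move=> a aP; rewrite !liftE; apply: dext_eq => //=; rewrite alphaW.
Qed.

Lemma lift_embedding : is_embedding_on W iota.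
Proof.
split; [| | | exact: lift_br | exact: lift_sq].
- by move=> a b _ _; rewrite !liftE => -[].
- by move=> a /memv_capP[_ ae]; rewrite liftE mem_ev.
- by move=> a /memv_capP[_ ao]; rewrite liftE mem_od /= ao !eqxx.
Qed.

Lemma Ks_lift_sub_superalgebra : is_sub_superalgebra (calKs + iota @: W)%VS.
Proof.
split.
- apply: graded_subspace => -[[p a] q]; rewrite mem_Ks_lift.
  move=> /andP[/= /eqP-> /sub_parity_split[a0 [a0W a0e] [a1 [a1W a1o] ->]]].
  exists (vec 0 a0 q); first by rewrite memv_cap mem_Ks_lift mem_ev /= a0W eqxx.
  exists (vec 0 a1 0); last by apply: dext_eq; rewrite /= ?addr0.
  by rewrite memv_cap mem_Ks_lift mem_od /= a1W a1o eqxx.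
- move=> t u; rewrite !mem_Ks_lift /= => /andP[_ aW] /andP[_ bW].
  by rewrite isoW ?DW // eqxx !rpredD ?rpredZ ?(sub_br subW) ?DW.
- move=> t /memv_capP[]; rewrite !mem_Ks_lift mem_od /= => /andP[_ aW].
  move=> /and3P[_ ao _].
  have aP : t.1.2 \in (W :&: od h)%VS by rewrite memv_cap aW.
  by rewrite alphaW // (sub_sq subW) // eqxx.
Qed.

Lemma lift_sub_superalgebra : is_sub_superalgebra (iota @: W)%VS.
Proof.
split.
- apply: graded_subspace => t /memv_imgP[a].
  move=> /sub_parity_split[a0 [a0W a0e] [a1 [a1W a1o] ->]] ->.
  exists (iota a0); first by rewrite memv_cap memv_img // liftE mem_ev.
  exists (iota a1); last exact: linearD.
  by rewrite memv_cap memv_img // liftE mem_od /= a1o !eqxx.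
- move=> t u /memv_imgP[a aW ->] /memv_imgP[b bW ->].
  by rewrite -lift_br // memv_img // (sub_br subW).
- move=> t /memv_capP[/memv_imgP[a aW ->]].
  rewrite liftE mem_od => /and3P[_ ao _].
  have aP : a \in (W :&: od h)%VS by rewrite memv_cap aW.
  by rewrite -liftE -lift_sq // memv_img // (sub_sq subW).
Qed.

Lemma Ks_sub_superalgebra : is_sub_superalgebra calKs.
Proof.
split.
- apply: graded_subspace => t tKs; exists t.
    move: tKs; rewrite memv_cap mem_ev mem_Ks => /andP[-> /eqP->].
    by rewrite mem0v eqxx.
  by exists 0; rewrite ?mem0v ?addr0.
- move=> t u; rewrite !mem_Ks /= => /andP[_ /eqP->] /andP[_ /eqP->].
  rewrite linear0 !scaler0 (bilinear0l bilB) (bilinear0l (br_bilinear lie_h)).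
  by rewrite !addr0 !eqxx.
- move=> t; rewrite memv_cap !mem_Ks /= => /andP[/andP[_ /eqP->] _].
  have /= := quad_alpha.1 0 _ (mem0v (od h)).
  by rewrite scale0r expr0n mul0r => ->; rewrite (sq0 lie_h) !eqxx.
Qed.

Lemma Ks_lift_semidirect :
  is_semidirect_product (calKs + iota @: W)%VS calKs (iota @: W)%VS.
Proof.
split.
- split=> //; apply/eqP; rewrite -subv0; apply/subvP=> t /memv_capP[].
  rewrite mem_Ks mem_lift memv0 => /andP[/eqP p0 /eqP a0] /and3P[_ _ /eqP q0].
  by apply/eqP/dext_eq.
- exact: Ks_sub_superalgebra.
- exact: lift_sub_superalgebra.
- move=> t u; rewrite mem_Ks_lift !mem_lift /=.
  move=> /andP[_ aW] /and3P[_ bW /eqP->].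
  by rewrite isoW ?DW // !eqxx scale0r addr0 rpredD ?rpredZ ?(sub_br subW) ?DW.
Qed.

Lemma K_lift_isotropic :
  isotropic (dext_form 0 : ht -> ht -> K) (calK + iota @: W)%VS.
Proof.
move=> t u; rewrite !mem_K_lift => /andP[aW /eqP q0] /andP[bW /eqP q0'].
by rewrite /dext_form q0 q0' !(mul0r, mulr0) !addr0 isoW.
Qed.

Lemma Ks_lift_isotropic :
  isotropic (dext_form 0 : ht -> ht -> K) (calKs + iota @: W)%VS.
Proof.
move=> t u; rewrite !mem_Ks_lift => /andP[/eqP p0 aW] /andP[/eqP p0' bW].
by rewrite /dext_form p0 p0' !(mul0r, mulr0) !addr0 isoW.
Qed.

End SubSuperalgebras.

(** * Manin triples *)

Section ManinTriples.
Variables (K : fieldType) (h : superAlg K) (g k : {vspace h}) (B : h -> h -> K).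
Hypothesis manin_h : is_Manin_triple_with h g k B.

(** A vector u + v orthogonal to k, with u in g and v in k, has u orthogonal to
    k, as k is isotropic, and to g, as g is; so u = 0 by nondegeneracy. *)
Lemma manin_perp_r (a : h) : {in k, forall b, B a b = 0} -> a \in k.
Proof.
have bilB := nis_bilinear (manin_nis manin_h).
move=> a_perp; have [gk _] := manin_sum manin_h.
have /memv_addP[u ug [v vk def_a]] : a \in (g + k)%VS by rewrite gk memvf.
suff u0 : u = 0 by rewrite def_a u0 add0r.
apply: (nis_nondeg (manin_nis manin_h)) => y.
have /memv_addP[y1 y1g [y2 y2k ->]] : y \in (g + k)%VS by rewrite gk memvf.
rewrite (bilinearDr bilB) (manin_iso_l manin_h) // add0r.
have := a_perp y2 y2k; rewrite def_a (bilinearDl bilB).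
by rewrite [B v y2](manin_iso_r manin_h) // addr0.
Qed.

(** For odd a in k, D a is odd, hence orthogonal to the even part of k; it is
    orthogonal to the odd part because B b (D a) is the polar form of alpha,
    which vanishes there. So D a lies in k by [manin_perp_r]. *)
Lemma derivation_stable_r (D : 'End(h)) (alpha : h -> K) :
    is_even_derivation D ->
    {in (k :&: ev h)%VS, forall a, D a \in (k :&: ev h)%VS} ->
    {in od h &, forall a b, alpha (a + b) + alpha a + alpha b = B a (D b)} ->
    {in (k :&: od h)%VS, forall a, alpha a = 0} ->
  {in k, forall a, D a \in k}.
Proof.
move=> derD Dk0 polar_alpha alpha_k1 a.
move=> /(sub_parity_split (manin_sub_r manin_h))
  [a0 [a0k a0e] [a1 [a1k a1o] ->]].
rewrite linearD rpredD //.
  have /Dk0 : a0 \in (k :&: ev h)%VS by rewrite memv_cap a0k.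
  by case/memv_capP.
apply: manin_perp_r => b.
move=> /(sub_parity_split (manin_sub_r manin_h))
  [b0 [b0k b0e] [b1 [b1k b1o] ->]].
rewrite (bilinearDr (nis_bilinear (manin_nis manin_h))).
rewrite !(nis_sym (manin_nis manin_h) (D a1)).
rewrite (manin_even manin_h) ?(der_od derD) // add0r -polar_alpha //.
by rewrite !alpha_k1 ?addr0 // memv_cap ?rpredD ?a1k ?b1k.
Qed.

End ManinTriples.

(** * The double extension of a Manin triple *)

Theorem theorem4p2p1 (K : fieldType) (charK2 : 2%N \in [pchar K])
  (h : superAlg K) (g k : {vspace h}) (B : h -> h -> K)
  (manin_h : is_Manin_triple_with h g k B)
  (D : 'End(h)) (derD : is_even_derivation D)
  (skewD : forall a b : h, B (D a) b + B a (D b) = 0)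
  (altD : {in ev h, forall a, B (D a) a = 0})
  (Dk0 : {in (k :&: ev h)%VS, forall a, D a \in (k :&: ev h)%VS})
  (alpha : h -> K) (quad_alpha : is_quadratic_form_on (od h) alpha)
  (polar_alpha : {in od h &, forall a b,
     alpha (a + b) + alpha a + alpha b = B a (D b)})
  (alpha_k1 : {in (k :&: od h)%VS, forall a, alpha a = 0})
  (c : K)
  (ht := dext B D alpha) (Bt : ht -> ht -> K := dext_form c)
  (iota : 'Hom(h, ht) := dext_lift B D alpha)
  (calK : {vspace ht} := dext_K B D alpha)
  (calKs : {vspace ht} := dext_Ks B D alpha)
  (gt : {vspace ht} := (calK + iota @: g)%VS)
  (kt : {vspace ht} := (calKs + iota @: k)%VS)
  (Bt_xs : Bt (dext_xs h) (dext_xs h) = 0) :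
  [/\ is_Manin_triple_with ht gt kt Bt,
      is_direct_sum calK (iota @: g)%VS gt,
      is_semidirect_product kt calKs (iota @: k)%VS
    & is_embedding_on k iota].
Proof.
have lie_h := manin_lie manin_h; have nisB := manin_nis manin_h.
have [evenB isok] := (manin_even manin_h, manin_iso_r manin_h).
have Dk := derivation_stable_r manin_h derD Dk0 polar_alpha alpha_k1.
have c0 : c = 0.
  move: Bt_xs; rewrite /Bt /dext_form /= (bilinear0l (nis_bilinear nisB)).
  by rewrite mul0r !mulr1 mulr0 !addr0 add0r.
have [gk_full gk0] := manin_sum manin_h.
split; [split | | |].
- exact: dext_lie_superalgebra.
- exact: K_lift_sub_superalgebra (manin_sub_l manin_h).
- exact: Ks_lift_sub_superalgebra (manin_sub_r manin_h) isok Dk alpha_k1.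
- split; apply/eqP; last first.
    rewrite -subv0; apply/subvP=> t /memv_capP[].
    rewrite mem_K_lift mem_Ks_lift memv0 => /andP[ag /eqP q0] /andP[/eqP p0 ak].
    have a0 : t.1.2 = 0 by apply/eqP; rewrite -memv0 -gk0 memv_cap ag.
    by apply/eqP/dext_eq.
  rewrite eqEsubv subvf; apply/subvP=> -[[p a] q] _.
  have /memv_addP[u ug [v vk ->]] : a \in (g + k)%VS by rewrite gk_full memvf.
  apply/memv_addP.
  exists (@dext_vec K h p u 0 : ht); first by rewrite mem_K_lift /= ug eqxx.
  exists (@dext_vec K h 0 v q : ht); first by rewrite mem_Ks_lift /= vk eqxx.
  by apply: dext_eq; rewrite /= ?addr0 ?add0r.
- exact: dext_NIS.
- exact: dext_form_even.
- by rewrite /Bt c0; apply: K_lift_isotropic (manin_iso_l manin_h).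
- by rewrite /Bt c0; apply: Ks_lift_isotropic (manin_iso_r manin_h).
- split=> //; apply/eqP; rewrite -subv0; apply/subvP=> t /memv_capP[].
  rewrite mem_K mem_lift memv0 => /andP[/eqP a0 /eqP q0] /and3P[/eqP p0 _ _].
  by apply/eqP/dext_eq.
- exact: Ks_lift_semidirect (manin_sub_r manin_h) isok Dk alpha_k1.
- exact: lift_embedding (manin_iso_r manin_h) Dk alpha_k1.
Qed.
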